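(* Let $q=2$ (signature $(p,2)$). In $\mathcal P\otimes\bigwedge^\bullet(\mathfrak p^* )$ one has \[ \omega(L)\varphi_{KM}=-dd^c\varphi_0, \] where $\varphi_0=1$ is the constant polynomial (the Gaussian in the Fock model).
   Context: $\mathcal P=\mathbb C[z_1,\dots,z_{p+2}]$ (variables $z_\alpha$, $1\le\alpha\le p$, and $z_{p+1},z_{p+2}$); $\mathfrak p\cong M_{p,2}(\mathbb R)$ with basis $X_{\alpha\mu}$ and dual basis $\omega_{\alpha\mu}$ ($1\le\alpha\le p$, $\mu\in\{p+1,p+2\}$); work in $\mathcal P\otimes\bigwedge^\bullet(\mathfrak p^* )$ (infinitesimal Fock model of the Weil representation tensored with forms). Operators on $\mathcal P$: $\omega(X_{\alpha\mu})=-4\pi\frac{\partial^2}{\partial z_\alpha\partial z_\mu}+\frac1{4\pi}z_\alpha z_\mu$; $\omega(L)=2\pi\sum_{\alpha=1}^p\frac{\partial^2}{\partial z_\alpha^2}-\frac1{8\pi}(z_{p+1}^2+z_{p+2}^2)$ (acting on the polynomial factor). $\partial=\frac12\sum_\alpha\omega(X_{\alpha,p+1}-iX_{\alpha,p+2})\otimes(\omega_{\alpha,p+1}+i\omega_{\alpha,p+2})$ and $\bar\partial=\frac12\sum_\alpha\omega(X_{\alpha,p+1}+iX_{\alpha,p+2})\otimes(\omega_{\alpha,p+1}-i\omega_{\alpha,p+2})$, where $\omega(\cdot)$ is extended linearly and the form factor acts by left exterior multiplication; $d^c=\frac1{4\pi i}(\partial-\bar\partial)$ and $dd^c=-\frac1{2\pi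 i}\partial\bar\partial$. $\varphi_{KM}=\big(\frac{-\sqrt2}{4\pi}\big)^2\sum_{\alpha_1,\alpha_2=1}^pz_{\alpha_1}z_{\alpha_2}\otimes\omega_{\alpha_1,p+1}\wedge\omega_{\alpha_2,p+2}$. *)

(* Defs.v *)
From mathcomp Require Import all_boot all_order all_algebra.
From mathcomp Require Import complex mpoly reals.
From mathcomp Require trigo.

Set Implicit Arguments.
Unset Strict Implicit.
Unset Printing Implicit Defensive.

Import GRing.Theory Num.Theory.

Local Open Scope ring_scope.
Local Open Scope complex_scope.

(* Exterior algebra over K on a basis (e_i) indexed by a finite type I, ordered
   by enum_rank, with coefficients in a K-module V.  The function F stands for
   \sum_S F(S) (x) e_S in V (x) Lambda(K^I), where e_S is the product of the e_i,
   i in S, in increasing order.  The exterior algebra itself is V = K^o. *)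
Notation extmod I V := {ffun {set I} -> V}.
Notation extalg I K := (extmod I K^o).

Section Exterior.
Variables (K : comNzRingType) (I : finType).
Implicit Types (V : lmodType K) (S T U : {set I}).

Definition inversions S T : nat :=
  #|[set x : I * I | [&& x.1 \in S, x.2 \in T & (enum_rank x.2 < enum_rank x.1)%N]]|.

(* e_S e_T = (-1)^(inversions S T) e_(S :|: T) when S and T are disjoint, and 0
   otherwise (lwedge_basis); lwedge a F is (id (x) a /\ _) F. *)
Definition lwedge V (a : extalg I K) (F : extmod I V) : extmod I V :=
  [ffun U : {set I} => \sum_(S : {set I} | S \subset U)
     ((-1) ^+ inversions S (U :\: S) * (a S : K)) *: F (U :\: S)].

Definition tens V (v : V) (a : extalg I K) : extmod I V :=
  [ffun S : {set I} => (a S : K) *: v].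

Definition ext_basis S : extalg I K := [ffun T : {set I} => (T == S)%:R].

Definition ext_gen (i : I) : extalg I K := ext_basis [set i].

Definition ext_map V (f : V -> V) (F : extmod I V) : extmod I V :=
  [ffun S : {set I} => f (F S)].

Lemma lwedge_basis S T :
  lwedge (ext_basis S) (ext_basis T) =
  if [disjoint S & T]
  then ((-1) ^+ inversions S T : K) *: ext_basis (S :|: T) else 0.
Proof.
apply/ffunP => U; rewrite ffunE.
have -> : (if [disjoint S & T]
  then ((-1) ^+ inversions S T : K) *: ext_basis (S :|: T) else 0) U
  = (if [disjoint S & T] && (U == S :|: T) then (-1) ^+ inversions S T else 0 : K).
  by case: ifP => _ /=; rewrite !ffunE // /GRing.scale /= -mulr_natr; case: eqP;
     rewrite ?mulr1 ?mulr0.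
have [SU|SU] := boolP (S \subset U); last first.
  rewrite big1 => [|X XU].
    case: andP => // -[_ /eqP E]; by rewrite E subsetUl in SU.
  rewrite !ffunE; case: eqP => [E|_]; last by rewrite mulr0 scale0r.
  by rewrite E (negbTE SU) in XU.
rewrite (bigD1 S) //= big1 ?addr0 => [|X /andP[_ /negbTE XS]]; last first.
  by rewrite !ffunE XS mulr0 scale0r.
rewrite !ffunE eqxx mulr1 /GRing.scale /=.
have -> : (U :\: S == T) = [disjoint S & T] && (U == S :|: T).
  apply/eqP/andP => [<-|[dST /eqP ->]].
    split; last by rewrite -[X in X == _](setID U S) (setIidPr SU).
    by rewrite disjoint_sym disjoints_subset setDE subsetIr.
  rewrite setDUl setDv set0U; apply/setDidPl; by rewrite disjoint_sym.
by case: andP => [[dST /eqP ->]|_]; rewrite ?mulr0 // mulr1 setDUl setDv set0U;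
  congr (_ ^+ inversions _ _); apply/setDidPl; rewrite disjoint_sym.
Qed.

Lemma lwedge1 V (F : extmod I V) : lwedge (ext_basis set0) F = F.
Proof.
apply/ffunP => U; rewrite ffunE (bigD1 set0) ?sub0set //= big1;
  last first.
  move=> X /andP[_ /negbTE X0]; by rewrite !ffunE X0 mulr0 scale0r.
rewrite !ffunE eqxx setD0 mulr1 addr0.
have -> : inversions set0 U = 0%N by apply: eq_card0 => x; rewrite !inE.
by rewrite expr0 scale1r.
Qed.

Lemma lwedge_tens V (v : V) (a b : extalg I K) :
  lwedge a (tens v b) = tens v (lwedge a b).
Proof.
apply/ffunP => U; rewrite !ffunE scaler_suml; apply: eq_bigr => S _.
by rewrite ffunE scalerA.
Qed.

Lemma inversionsUl S T U : [disjoint S & T] ->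
  inversions (S :|: T) U = (inversions S U + inversions T U)%N.
Proof.
move=> dST; rewrite /inversions -cardsUI [X in (_ + X)%N]eq_card0 ?addn0 => [|x].
  by apply: eq_card => x; rewrite !inE; do !case: (_ \in _); case: (_ < _)%N.
rewrite !inE; case xS: (x.1 \in S) => //=.
by rewrite (disjointFr dST xS) /= andbF.
Qed.

Lemma inversionsUr S T U : [disjoint T & U] ->
  inversions S (T :|: U) = (inversions S T + inversions S U)%N.
Proof.
move=> dTU; rewrite /inversions -cardsUI [X in (_ + X)%N]eq_card0 ?addn0 => [|x].
  by apply: eq_card => x; rewrite !inE; do !case: (_ \in _); case: (_ < _)%N.
rewrite !inE; case xT: (x.2 \in T) => /=; last by rewrite andbF.
by rewrite (disjointFr dTU xT) /= !andbF.
Qed.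

Lemma lwedgeA V (a b : extalg I K) (F : extmod I V) :
  lwedge a (lwedge b F) = lwedge (lwedge a b) F.
Proof.
apply/ffunP => U; rewrite !ffunE.
under [RHS]eq_bigr => W WU do rewrite ffunE mulr_sumr scaler_suml.
rewrite (exchange_big_dep (fun S : {set I} => S \subset U)) /=; last first.
  by move=> W S WU SW; apply: subset_trans SW WU.
apply: eq_bigr => S SU; rewrite ffunE scaler_sumr.
rewrite [RHS](reindex_onto (fun T => S :|: T) (fun W => W :\: S)) /=; last first.
  by move=> W /andP[_ SW]; rewrite -[RHS](setID W S) (setIidPr SW).
apply: eq_big => T.
  rewrite subUset SU subsetUl /= andbT subsetD setDUl setDv set0U.
  congr (_ && _); apply/idP/eqP => [dTS|<-]; first exact/setDidPl.
  by rewrite disjoint_sym disjoints_subset setDE setCI setCK subsetUr.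
rewrite subsetD => /andP[TU dTS].
have dST : [disjoint S & T] by rewrite disjoint_sym.
have E : (S :|: T) :\: S = T by rewrite setDUl setDv set0U; apply/setDidPl.
have E2 : U :\: S = T :|: (U :\: (S :|: T)).
  apply/setP => x; rewrite !inE; case xT: (x \in T) => /=.
    by rewrite (subsetP TU) // (disjointFr dTS xT).
  by rewrite orbF.
rewrite E setDDl scalerA E2 inversionsUr; last first.
  by rewrite disjoints_subset setDE setCI setCK subsetU // subsetUr orbT.
rewrite inversionsUl // !exprD /GRing.scale /=; congr (_ *: _).
have mulACA (e f g x y : K) : e * f * x * (g * y) = f * g * (e * x * y).
  by rewrite mulrACA -(mulrA e x) [RHS]mulrA -(mulrA e f) (mulrC e).
exact: mulACA.
Qed.

End Exterior.

Section Fock.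
Variables (R : realType) (p : nat).
Local Notation C := R[i].
Local Notation P := {mpoly C[p + 2]}.

(* z_alpha is 'X_(zpos alpha) and z_mu is 'X_(zneg mu); the index mu = p + 1
   (resp. p + 2) is encoded as 0 (resp. 1) in 'I_2. *)
Definition mu1 : 'I_2 := ord0.
Definition mu2 : 'I_2 := ord_max.

Local Notation form_index := ('I_p * 'I_2)%type.

Definition piC : C := (trigo.pi : R)%:C%C.

Definition zpos (a : 'I_p) : 'I_(p + 2) := lshift 2 a.
Definition zneg (m : 'I_2) : 'I_(p + 2) := rshift p m.

Definition Xbasis (a : 'I_p) (m : 'I_2) : 'M[C]_(p, 2) := delta_mx a m.

Definition omega_form (a : 'I_p) (m : 'I_2) : extalg form_index C :=
  ext_gen C (a, m).

(* omega(X_(alpha mu)), extended C-linearly in X to the complexification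
   of M_(p,2)(R), in which X_(alpha mu) is an elementary matrix. *)
Definition omega (X : 'M[C]_(p, 2)) (f : P) : P :=
  \sum_(a < p) \sum_(m < 2) X a m *:
    ((- (4 * piC)) *: mderiv (zpos a) (mderiv (zneg m) f)
     + (4 * piC)^-1 *: ('X_(zpos a) * 'X_(zneg m) * f)).

Definition omegaL (f : P) : P :=
  (2 * piC) *: (\sum_(a < p) mderiv (zpos a) (mderiv (zpos a) f))
  - (8 * piC)^-1 *: (('X_(zneg mu1) ^+ 2 + 'X_(zneg mu2) ^+ 2) * f).

Definition del (F : extmod form_index P) : extmod form_index P :=
  2^-1 *: \sum_(a < p)
    lwedge (omega_form a mu1 + 'i%C *: omega_form a mu2)
      (ext_map (omega (Xbasis a mu1 - 'i%C *: Xbasis a mu2)) F).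

Definition delbar (F : extmod form_index P) : extmod form_index P :=
  2^-1 *: \sum_(a < p)
    lwedge (omega_form a mu1 - 'i%C *: omega_form a mu2)
      (ext_map (omega (Xbasis a mu1 + 'i%C *: Xbasis a mu2)) F).

Definition ddc (F : extmod form_index P) : extmod form_index P :=
  (- (2 * piC * 'i%C)^-1) *: del (delbar F).

Definition phi0 : extmod form_index P := tens 1 (ext_basis C set0).

Definition phiKM : extmod form_index P :=
  ((- (Num.sqrt (2 : R))%:C%C / (4 * piC)) ^+ 2) *:
  \sum_(a1 < p) \sum_(a2 < p)
    tens ('X_(zpos a1) * 'X_(zpos a2))
      (lwedge (omega_form a1 mu1) (omega_form a2 mu2)).

End Fock.

(* Main.v *)
(* The (1,0)- and (0,1)-parts of the form factor of del delbar 1 are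
   w_(a,1) + i w_(a,2) and w_(b,1) - i w_(b,2).  The polynomial factor of the
   (a, b) term is symmetric in a and b, whereas the 1-forms anticommute, so that
   only -2i times the mixed terms w_(a,1) w_(b,2) survives.  The polynomial
   factor is a Laplacian term in delta_(a,b) plus
   z_a z_b (z_(p+1)^2 + z_(p+2)^2), i.e. a multiple of omega(L)(z_a z_b). *)

Require Import Defs.
From mathcomp Require Import all_boot all_order all_algebra.
From mathcomp Require Import complex mpoly reals.
From HB Require Import structures.
From mathcomp Require trigo.
From mathcomp Require Import ring.
Import GRing.Theory Num.Theory.
Local Open Scope ring_scope.

(** * Bilinearity of the wedge product and anticommutation of the generators *)

Section ExteriorLinearity.
Variables (K : comNzRingType) (I : finType).
Implicit Types (V : lmodType K).

Lemma lwedge_linear_r V (a : extalg I K) : linear (@lwedge K I V a).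
Proof.
move=> k F G; apply/ffunP => U; rewrite !ffunE scaler_sumr -big_split.
by apply: eq_bigr => S _; rewrite !ffunE scalerDr !scalerA [k * _]mulrC.
Qed.

HB.instance Definition _ V (a : extalg I K) :=
  GRing.isLinear.Build K (extmod I V) (extmod I V) _ (@lwedge K I V a)
    (lwedge_linear_r V a).

Lemma lwedgeDl V (a b : extalg I K) (F : extmod I V) :
  lwedge (a + b) F = lwedge a F + lwedge b F.
Proof.
apply/ffunP => U; rewrite !ffunE -big_split.
by apply: eq_bigr => S _; rewrite !ffunE mulrDr scalerDl.
Qed.

Lemma lwedgeZl V (k : K) (a : extalg I K) (F : extmod I V) :
  lwedge (k *: a) F = k *: lwedge a F.
Proof.
apply/ffunP => U; rewrite !ffunE scaler_sumr.
by apply: eq_bigr => S _; rewrite !ffunE scalerA mulrCA.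
Qed.

Lemma lwedgeDr V (a : extalg I K) (F G : extmod I V) :
  lwedge a (F + G) = lwedge a F + lwedge a G.
Proof. exact: linearD. Qed.

Lemma lwedgeZr V (k : K) (a : extalg I K) (F : extmod I V) :
  lwedge a (k *: F) = k *: lwedge a F.
Proof. exact: linearZ. Qed.

Lemma ext_map_linear V (f : {linear V -> V}) : linear (@ext_map K I V f).
Proof. by move=> k F G; apply/ffunP => S; rewrite !ffunE linearP. Qed.

HB.instance Definition _ V (f : {linear V -> V}) :=
  GRing.isLinear.Build K (extmod I V) (extmod I V) _ (@ext_map K I V f)
    (ext_map_linear V f).

Lemma ext_map_tens V (f : {linear V -> V}) (v : V) (a : extalg I K) :
  ext_map f (tens v a) = tens (f v) a.
Proof. by apply/ffunP => S; rewrite !ffunE linearZ. Qed.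

Lemma tensZl V (k : K) (v : V) (a : extalg I K) :
  tens (k *: v) a = k *: tens v a.
Proof. by apply/ffunP => S; rewrite !ffunE !scalerA mulrC. Qed.

Lemma tensDr V (v : V) (a b : extalg I K) :
  tens v (a + b) = tens v a + tens v b.
Proof. by apply/ffunP => S; rewrite !ffunE scalerDl. Qed.

Lemma tensZr V (k : K) (v : V) (a : extalg I K) :
  tens v (k *: a) = k *: tens v a.
Proof. by apply/ffunP => S; rewrite !ffunE scalerA. Qed.

(** For i = j both products vanish by [lwedge_basis]. For i <> j exactly one of the two orders of
    the generators has an inversion, so the signs in front of the common basis vector are
    opposite. *)
Lemma lwedge_ext_gen_anti (i j : I) :
  lwedge (ext_gen K i) (ext_gen K j) = - lwedge (ext_gen K j) (ext_gen K i).
Proof.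
rewrite /ext_gen !lwedge_basis disjoint_sym disjoints1 inE.
have [_|nij] := eqVneq; first by rewrite oppr0.
have inv1 (k l : I) :
    inversions [set k] [set l] = (enum_rank l < enum_rank k)%N :> nat.
  rewrite /inversions; case: ltnP => lk.
    apply: (@eq_card1 _ (k, l)) => -[x y]; rewrite !inE /= xpair_eqE.
    by case: eqP => //= ->; case: eqP => //= ->.
  apply: eq_card0 => -[x y]; rewrite !inE /=; apply/and3P.
  by case=> /eqP -> /eqP ->; rewrite ltnNge lk.
have nr : enum_rank i != enum_rank j :> nat.
  by apply: contraNneq nij => /val_inj/enum_rank_inj ->.
rewrite setUC !inv1 -scaleNr.
by case: ltngtP nr => //= _ _; rewrite expr0 expr1 ?opprK.
Qed.

Lemma lwedge_basis0 (a : extalg I K) : lwedge a (ext_basis K set0) = a.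
Proof.
apply/ffunP => U; rewrite ffunE (bigD1 U) //= big1 ?addr0 => [|S /andP[SU nSU]].
  rewrite !ffunE setDv eqxx /inversions eq_card0 => [|x]; last first.
    by rewrite !inE andbF.
  by rewrite expr0 mul1r /GRing.scale /= mulr1.
rewrite ffunE setD_eq0.
have -> : (U \subset S) = false.
  by apply: contraNF nSU => US; rewrite eqEsubset SU.
by rewrite scaler0.
Qed.

End ExteriorLinearity.

(** * Double sums of 2-forms with symmetric coefficients *)

Section SymmetricSum.
Variables (K : numFieldType) (I T : finType) (V : lmodType K).
Variables (S : T -> T -> V).
Hypothesis S_sym : forall a b, S a b = S b a.
Local Notation e := (ext_gen K).

Definition wedge_sum (g h : T -> I) : extmod I V :=
  \sum_a \sum_b tens (S a b) (lwedge (e (g a)) (e (h b))).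

Lemma wedge_sum_anti (g h : T -> I) : wedge_sum g h = - wedge_sum h g.
Proof.
rewrite {1}/wedge_sum exchange_big -sumrN; apply: eq_bigr => a _.
rewrite -sumrN; apply: eq_bigr => b _.
by rewrite S_sym lwedge_ext_gen_anti -scaleN1r tensZr scaleN1r.
Qed.

(** By antisymmetry twice the sum is 0, and 2 is invertible in a [numFieldType]. *)
Lemma wedge_sum_alt (g : T -> I) : wedge_sum g g = 0.
Proof.
apply/eqP; have /eqP := wedge_sum_anti g g.
rewrite -subr_eq0 opprK -mulr2n -scaler_nat scaler_eq0.
by rewrite (pnatr_eq0 K).
Qed.

(** Of the four sums in the bilinear expansion, the two pure ones vanish, and the mixed ones, with
    coefficients -k and k, are opposite up to these coefficients and so add up. *)
Lemma sum_lwedge_conj (k : K) (g h : T -> I) :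
  \sum_a \sum_b tens (S a b)
    (lwedge (e (g a) + k *: e (h a)) (e (g b) + (- k) *: e (h b)))
  = (- (2 * k)) *: wedge_sum g h.
Proof.
transitivity (wedge_sum g g + (- k) *: wedge_sum g h
  + (k *: wedge_sum h g + (k * - k) *: wedge_sum h h)).
  rewrite /wedge_sum !scaler_sumr -!big_split; apply: eq_bigr => a _ /=.
  rewrite !scaler_sumr -!big_split; apply: eq_bigr => b _ /=.
  by rewrite lwedgeDl lwedgeZl !lwedgeDr !lwedgeZr scalerDr scalerA
    !tensDr !tensZr.
rewrite !wedge_sum_alt scaler0 addr0 add0r (wedge_sum_anti h g).
by rewrite scalerN -scaleNr -scalerDl; congr (_ *: _); ring.
Qed.

End SymmetricSum.

(** * Second-order differential operators on polynomials *)

Section DifferentialOperators.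
Variables (K : comNzRingType) (n : nat).
Implicit Types (g : {mpoly K[n]}).

Lemma diffop_linear (c d : K) (i j : 'I_n) g :
  linear (fun f => c *: f^`M(j)^`M(i) + d *: (g * f)).
Proof.
move=> k f h; rewrite !(mderivD, mderivZ) mulrDr -scalerAr !scalerDr !scalerA.
by rewrite addrACA (mulrC k) (mulrC k).
Qed.

Lemma laplace_linear (m : nat) (c d : K) (i : 'I_m -> 'I_n) g :
  linear (fun f => c *: (\sum_a f^`M(i a)^`M(i a)) - d *: (g * f)).
Proof.
move=> k f h; under eq_bigr => a _ do rewrite !(mderivD, mderivZ).
rewrite big_split -scaler_sumr /= mulrDr -scalerAr !scalerDr !scalerA opprD.
by rewrite addrACA scalerN scalerA (mulrC k) (mulrC k).
Qed.

Lemma mderivU (i j : 'I_n) : ('X_j : {mpoly K[n]})^`M(i) = (i == j)%:R.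
Proof.
rewrite mderivX mnm1E eq_sym; have [->|_] := eqVneq; last by rewrite scale0r.
by rewrite -[X in (X - _)%MM]add0m addmK mpolyX0 scale1r.
Qed.

Lemma mderiv_nat (i : 'I_n) (m : nat) : (m%:R : {mpoly K[n]})^`M(i) = 0.
Proof. by rewrite -mpolyC_nat mderivC. Qed.

Lemma mderiv2_XX (a b k : 'I_n) :
  ('X_a * 'X_b : {mpoly K[n]})^`M(k)^`M(k) = (2 * ((k == a) && (k == b))%:R).
Proof.
rewrite mderivM !mderivU mderivD !mderivM !mderivU !mderiv_nat.
by do 2!case: eqP => _ /=; ring.
Qed.

(** Injectivity makes the chosen variables distinct, so only the term c = a can contribute. *)
Lemma laplace_XX (m : nat) (i : 'I_m -> 'I_n) (a b : 'I_m) :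
  injective i ->
  \sum_c ('X_(i a) * 'X_(i b) : {mpoly K[n]})^`M(i c)^`M(i c) =
  2 * (a == b)%:R.
Proof.
move=> inj_i; rewrite (bigD1 a) //= big1 ?addr0 => [|c ca].
  by rewrite mderiv2_XX eqxx (inj_eq inj_i).
by rewrite mderiv2_XX (inj_eq inj_i) (negbTE ca) mulr0.
Qed.

(* With [w = z1 + k z2] and [k ^ 2 = -1] the operator [d1 - k d2] sends [w]
   to [2], while [(z1 - k z2) w = z1 ^ 2 + z2 ^ 2]. *)
Lemma diffop_conj (c d k : K) (a b z1 z2 : 'I_n) (f := 'X_z1 + k *: 'X_z2) :
  k ^+ 2 = -1 -> z1 != z2 -> a != z1 -> a != z2 ->
  c *: (('X_a * f)^`M(z1) + (- k) *: ('X_a * f)^`M(z2))^`M(b)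
  + d *: ('X_b * ('X_z1 + (- k) *: 'X_z2) * ('X_a * f)) =
  c *: (2 * (a == b)%:R)
  + d *: (('X_z1 ^+ 2 + 'X_z2 ^+ 2) * ('X_a * 'X_b)).
Proof.
move=> k2 z12 az1 az2; rewrite /f -![_ *: 'X_z2]mul_mpolyC mpolyCN.
have kk : k%:MP * k%:MP = -1 :> {mpoly K[n]}.
  by rewrite -mpolyCM -expr2 k2 mpolyCN mpolyC1.
congr (_ *: _ + _ *: _); last by ring: kk.
have -> : ('X_a * ('X_z1 + k%:MP * 'X_z2))^`M(z1)
    + (- k) *: ('X_a * ('X_z1 + k%:MP * 'X_z2))^`M(z2) = 2 * 'X_a.
  rewrite !mderivM !mderivD !mderivM !mderivC !mderivU !eqxx (eq_sym z2 z1).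
  rewrite (eq_sym z1 a) (eq_sym z2 a) (negbTE az1) (negbTE az2) (negbTE z12).
  by rewrite -mul_mpolyC mpolyCN /=; ring: kk.
by rewrite mderivM mderiv_nat mderivU mul0r add0r eq_sym.
Qed.

End DifferentialOperators.

(** Comparison of constants for x = pi and k = i; both sides equal -1 / (16 x^2). On the left, the
    factor of [phiKM] times the -1/2 of [omegaL_coef]; on the right, minus the factor of [ddc] times
    that of [del_delbar_phi0]. *)
Lemma ddc_coef (K : numFieldType) (x k : K) : x != 0 -> k ^+ 2 = -1 ->
  2 / (4 * x) ^+ 2 * - 2^-1 =
  - (- (2 * x * k)^-1 * (2^-1 * ((2 * (4 * x))^-1 * - (2 * k)))).
Proof.
move=> x0 k2; have k0 : k != 0.
  by apply: contra_eq_neq k2 => ->; rewrite expr0n eq_sym oppr_eq0 oner_eq0.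
by field; rewrite x0 k0.
Qed.

(** The coefficients of [omegaL] are -1/2 times those of [omega] on an elementary matrix; this makes
    [omegaL] of z_a z_b proportional to [ddc_poly]. *)
Lemma omegaL_coef (K : numFieldType) (V : lmodType K) (x : K) (u v : V) :
  (2 * x) *: u - (8 * x)^-1 *: v =
  - 2^-1 *: (- (4 * x) *: u + (4 * x)^-1 *: v).
Proof.
rewrite scalerDr !scalerA mulrNN -scaleNr mulNr -invfM !mulrA.
by congr (_ *: _ + (- (_ * _)^-1) *: _); field.
Qed.

(** * The operators of the Fock model and the evaluation of del delbar on the Gaussian *)

Section Fock.
Variables (R : realType) (p : nat).
Local Notation C := R[i].
Local Notation P := {mpoly C[p + 2]}.
Local Notation form_index := ('I_p * 'I_2)%type.
Local Notation w := (omega_form R).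
Local Notation im := ('i%C : C).

Lemma omega_linear (X : 'M[C]_(p, 2)) : linear (omega X).
Proof.
move=> k f g; rewrite /omega scaler_sumr -big_split; apply: eq_bigr => a _.
rewrite scaler_sumr -big_split; apply: eq_bigr => m _ /=.
by rewrite scalerA (mulrC k) -scalerA -scalerDr;
  congr (_ *: _); exact: diffop_linear.
Qed.

HB.instance Definition _ X :=
  GRing.isLinear.Build C P P _ (@omega R p X) (omega_linear X).

Lemma omegaL_linear : linear (@omegaL R p).
Proof. exact: laplace_linear. Qed.

HB.instance Definition _ :=
  GRing.isLinear.Build C P P _ (@omegaL R p) omegaL_linear.

Lemma piC_neq0 : piC R != 0.
Proof. by rewrite /piC fmorph_eq0 lt0r_neq0 // trigo.pi_gt0. Qed.

Lemma omega_Xbasis (a : 'I_p) (k : C) (f : P) :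
  omega (Xbasis R a mu1 + k *: Xbasis R a mu2) f =
  - (4 * piC R) *:
    mderiv (zpos a) (mderiv (zneg p mu1) f + k *: mderiv (zneg p mu2) f)
  + (4 * piC R)^-1 *:
    ('X_(zpos a) * ('X_(zneg p mu1) + k *: 'X_(zneg p mu2)) * f).
Proof.
rewrite /omega (bigD1 a) //= [X in _ + X]big1 ?addr0; last first.
  move=> b ba; rewrite big1 // => m _.
  by rewrite !mxE (negbTE ba) /= mulr0 addr0 scale0r.
have E : lift ord0 ord0 = mu2 by exact: val_inj.
rewrite big_ord_recl big_ord1 E !mxE !eqxx /= mulr0 mulr1 addr0 add0r scale1r.
rewrite mulrDr mulrDl mderivD mderivZ -scalerAr -scalerAl !scalerDr !scalerA.
by rewrite addrACA (mulrC k) (mulrC k).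
Qed.

(** Of type (1,0) for k = i and of type (0,1) for k = -i. *)
Definition hol_form (k : C) (a : 'I_p) : extalg form_index C :=
  w a mu1 + k *: w a mu2.

Lemma del_sum_tens (f : 'I_p -> P) (e : 'I_p -> extalg form_index C) :
  del (\sum_a tens (f a) (e a)) =
  2^-1 *: \sum_b \sum_a
    tens (omega (Xbasis R b mu1 + (- im) *: Xbasis R b mu2) (f a))
         (lwedge (hol_form im b) (e a)).
Proof.
rewrite /del; congr (_ *: _); apply: eq_bigr => b _.
rewrite !linear_sum; apply: eq_bigr => a _.
by rewrite -scaleNr /= ext_map_tens lwedge_tens.
Qed.

Lemma delbar_phi0 :
  delbar (phi0 R p) = \sum_a
    tens ((2 * (4 * piC R))^-1 *:
           ('X_(zpos a) * ('X_(zneg p mu1) + im *: 'X_(zneg p mu2))))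
         (hol_form (- im) a).
Proof.
rewrite /delbar scaler_sumr; apply: eq_bigr => a _.
rewrite /phi0 ext_map_tens lwedge_tens /= omega_Xbasis.
(* The derivatives kill the constant 1, so only the multiplication part of [omega] survives. *)
rewrite -mpolyC1 !mderivC scaler0 addr0 mderiv0 scaler0 add0r mpolyC1 mulr1.
by rewrite lwedge_basis0 -tensZl scalerA -invfM /hol_form scaleNr.
Qed.

Local Notation r2 := ('X_(zneg p mu1) ^+ 2 + 'X_(zneg p mu2) ^+ 2 : P).

(* 4 pi omega(X_(b,1) - i X_(b,2)) omega(X_(a,1) + i X_(a,2)) 1. *)
Definition ddc_poly (a b : 'I_p) : P :=
  - (4 * piC R) *: (2 * (a == b)%:R)
  + (4 * piC R)^-1 *: (r2 * ('X_(zpos a) * 'X_(zpos b))).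

Lemma del_delbar_phi0 :
  del (delbar (phi0 R p)) =
  (2^-1 * ((2 * (4 * piC R))^-1 * - (2 * im))) *: \sum_a \sum_b
    tens (ddc_poly a b) (lwedge (w a mu1) (w b mu2)).
Proof.
have ddc_poly_sym a b : ddc_poly a b = ddc_poly b a.
  by rewrite /ddc_poly eq_sym ['X_(zpos a) * _]mulrC.
(* With k = i the first wedge factor is the (1,0)-form from [del] and the second the (0,1)-form from
   [delbar]. *)
have := sum_lwedge_conj _ _ _ _ ddc_poly ddc_poly_sym im
  (pair^~ mu1) (pair^~ mu2).
rewrite /wedge_sum delbar_phi0 del_sum_tens => E; rewrite -!scalerA -E.
congr (_ *: _); rewrite scaler_sumr; apply: eq_bigr => b _.
rewrite scaler_sumr; apply: eq_bigr => a _.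
rewrite linearZ tensZl /=; congr (_ *: tens _ _).
(* Here b is the index of [del] and a that of [delbar]; symmetry restores the order in which
   [diffop_conj] gives them. *)
rewrite omega_Xbasis ddc_poly_sym; apply: diffop_conj; first exact: sqr_i.
- by rewrite (inj_eq (@rshift_inj _ _)).
- by rewrite eq_lrshift.
- by rewrite eq_lrshift.
Qed.

Lemma omegaL_XX (a b : 'I_p) :
  omegaL ('X_(zpos a) * 'X_(zpos b)) = - 2^-1 *: ddc_poly a b.
Proof.
rewrite /omegaL laplace_XX; last exact: lshift_inj.
exact: omegaL_coef.
Qed.

End Fock.

Theorem theorem4p4 (R : realType) (p : nat) :
  ext_map (@omegaL R p) (phiKM R p) = - ddc (phi0 R p).
Proof.
rewrite /ddc del_delbar_phi0 /phiKM linearZ /= linear_sum scalerA -scaleNr.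
have sqrt2 : (Num.sqrt (2 : R))%:C%C ^+ 2 = 2 :> R[i].
  by rewrite -rmorphXn sqr_sqrtr ?ler0n //= rmorph_nat.
(* Once the factor of [phiKM] is split off on the right, the remaining -1/2 goes into the sum, where
   [omegaL_XX] matches it term by term. *)
rewrite expr_div_n sqrrN sqrt2 -ddc_coef ?piC_neq0 ?sqr_i // -[in RHS]scalerA.
congr (_ *: _); rewrite scaler_sumr; apply: eq_bigr => a _.
rewrite linear_sum scaler_sumr; apply: eq_bigr => b _.
by rewrite /= ext_map_tens /= omegaL_XX tensZl.
Qed.
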